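(* Let $X$ be a Banach space and $N\in\mathbb{N}$. If $X$ is octahedral, then the $N$-fold injective symmetric tensor product $\widehat{\otimes}_{\varepsilon,s,N}X$ is octahedral.
   Context: All Banach spaces are real and non-zero. $B_X$ and $S_X$ denote the closed unit ball and the unit sphere of $X$. A Banach space $X$ is octahedral (OH) if for every $x_1,\ldots,x_n\in S_X$ and $\varepsilon>0$ there exists $y\in S_X$ such that $\|x_i+y\|>2-\varepsilon$ for all $i\in\{1,\ldots,n\}$. The $N$-fold symmetric tensor product $\otimes^{s,N}X$ is the linear span of the tensors $x^N:=x\otimes\cdots\otimes x$ in the $N$-fold tensor product $\otimes^N X$. The $N$-fold injective symmetric tensor product $\widehat{\otimes}_{\varepsilon,s,N}X$ is the completion of $\otimes^{s,N}X$ under the norm $\|u\|:=\sup\{|\sum_{i=1}^n \lambda_i\, x^*(x_i)^N| : x^*\in B_{X^*}\}$, where $u=\sum_{i=1}^n\lambda_i x_i^N$ with $\lambda_i\in\mathbb{R}$, $x_i\in X$. *)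

(* Defs.v *)
From HB Require Import structures.
From mathcomp Require Import all_boot all_order all_algebra.
From mathcomp Require Import all_classical all_reals all_analysis.

Set Implicit Arguments.
Unset Strict Implicit.
Unset Printing Implicit Defensive.

Import Order.TTheory GRing.Theory Num.Theory.
Import numFieldNormedType.Exports.
Local Open Scope classical_set_scope.
Local Open Scope ring_scope.

(* The empty family (n = 0) is allowed: it only asserts that the unit sphere
   is nonempty, i.e. that X is non-zero. *)
Definition octahedral (R : realType) (X : normedModType R) : Prop :=
  forall (n : nat) (x : 'I_n -> X) (e : R),
    (forall i, `|x i| = 1) -> 0 < e ->
    exists2 y : X, `|y| = 1 & forall i, 2 - e < `|x i + y|.

Definition is_span (R : pzRingType) (V : lmodType R) (A : set V) (v : V) : Prop :=
  exists (n : nat) (l : 'I_n -> R) (a : 'I_n -> V),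
    (forall i, A (a i)) /\ v = \sum_(i < n) l i *: a i.

Definition span_pred (R : pzRingType) (V : lmodType R) (A : set V) : {pred V} :=
  fun v => `[< is_span A v >].

Lemma span_submod_closed (R : pzRingType) (V : lmodType R) (A : set V) :
  submod_closed (span_pred A).
Proof.
split; first by apply/asboolP; exists 0, (fun=> 0), (fun=> 0); split=> [[]|]//;
  rewrite big_ord0.
move=> c u v /asboolP[n [l [a [Aa ->]]]] /asboolP[m [k [b [Ab ->]]]].
apply/asboolP; exists (n + m)%N.
exists (fun i => match fintype.split i with inl j => c * l j | inr j => k j end).
exists (fun i => match fintype.split i with inl j => a j | inr j => b j end).
split=> [i|]; first by case: (fintype.split i).
rewrite big_split_ord/= scaler_sumr; congr (_ + _); apply: eq_bigr => i _.
  by rewrite (unsplitK (inl i)) scalerA.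
by rewrite (unsplitK (inr i)).
Qed.

HB.instance Definition _ (R : pzRingType) (V : lmodType R) (A : set V) :=
  GRing.isSubmodClosed.Build R V (span_pred A) (span_submod_closed A).

(* The linear span of A, as a vector space of its own. *)
Record lin_span (R : pzRingType) (V : lmodType R) (A : set V) :=
  Span { span_val :> V ; _ : span_val \in span_pred A }.

HB.instance Definition _ (R : pzRingType) (V : lmodType R) (A : set V) :=
  [isSub for @span_val R V A].
HB.instance Definition _ (R : pzRingType) (V : lmodType R) (A : set V) :=
  [Choice of lin_span A by <:].
HB.instance Definition _ (R : pzRingType) (V : lmodType R) (A : set V) :=
  [SubChoice_isSubLmodule of lin_span A by <:].

Lemma span_gen_subproof (R : pzRingType) (V : lmodType R) (A : set V) (v : V) :
  A v -> v \in span_pred A.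
Proof.
by move=> Av; apply/asboolP; exists 1, (fun=> 1), (fun=> v); split=> //;
  rewrite big_ord1 scale1r.
Qed.

Definition span_gen (R : pzRingType) (V : lmodType R) (A : set V) (v : V)
  (Av : A v) : lin_span A := Span (span_gen_subproof Av).

Lemma span_valZ (R : pzRingType) (V : lmodType R) (A : set V) (c : R)
  (u : lin_span A) : span_val (c *: u) = c *: span_val u.
Proof. exact: SubK. Qed.

Lemma span_val_lin (R : pzRingType) (V : lmodType R) (A : set V) (n : nat)
    (l : 'I_n -> R) (a : 'I_n -> lin_span A) :
  span_val (\sum_(i < n) l i *: a i) = \sum_(i < n) l i *: span_val (a i).
Proof.
rewrite -[LHS]/((val : {linear lin_span A -> V}) _) raddf_sum.
by apply: eq_bigr => i _; rewrite -span_valZ.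
Qed.

Section TensorPower.
Variables (R : realType) (X : lmodType R) (N : nat).

(* [dfwith x i u] is the family x with its i-th entry replaced by u. *)
Definition multilinear (W : lmodType R) (f : ('I_N -> X) -> W) : Prop :=
  forall (x : 'I_N -> X) (i : 'I_N), linear (fun u : X => f (dfwith x i u)).

Record mform := MForm {
  mform_fun :> ('I_N -> X) -> R^o ;
  mformP : multilinear mform_fun }.

(* x_1 (x) ... (x) x_N is the evaluation functional at (x_1, ..., x_N) on the
   N-linear forms; the algebraic tensor product is the span of these functionals
   (the construction of Ryan's "Introduction to Tensor Products of Banach
   Spaces"; over a field it has the usual universal property, because linear
   functionals separate the points of any vector space). *)
Definition eval_mform (x : 'I_N -> X) : mform -> R^o := fun A => A x.

Definition tensor_power := lin_span (range eval_mform).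

Definition tensor (x : 'I_N -> X) : tensor_power :=
  span_gen (imageT eval_mform x).

Definition tpow (x : X) : tensor_power := tensor (fun=> x).

Definition sym_tensor := lin_span (range tpow).

Definition stpow (x : X) : sym_tensor := span_gen (imageT tpow x).

Lemma tensor_multilinear : multilinear tensor.
Proof.
move=> x i c u v; apply: val_inj; apply/funext => A.
exact: (mformP A x i c u v).
Qed.

Lemma sym_tensorP (u : sym_tensor) :
  exists (n : nat) (l : 'I_n -> R) (x : 'I_n -> X),
    u = \sum_(i < n) l i *: stpow (x i).
Proof.
case: u => u uP; have /asboolP[n [l [a [ra uE]]]] := uP.
have {}ra i : exists x, tpow x = a i by have [x _ <-] := ra i; exists x.
exists n, l, (fun i => sval (cid (ra i))); apply: val_inj => /=.
rewrite uE span_val_lin; apply: eq_bigr => i _ /=.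
by rewrite (svalP (cid (ra i))).
Qed.

End TensorPower.

(* The closed unit ball of the dual X^*: a linear functional of norm at most 1
   is automatically continuous. *)
Definition dual_ball (R : realType) (X : normedModType R) : set {scalar X} :=
  [set phi : {scalar X} | forall x : X, `|x| <= 1 -> `|phi x| <= 1].

(* sup of | sum_i l_i phi(x_i)^N | over phi in the dual ball, where
   u = sum_i l_i x_i^N. All representations of u are ranged over, so that no
   choice is needed; [inj_normE] shows that any single one gives the same value. *)
Definition inj_norm (R : realType) (X : normedModType R) (N : nat)
    (u : sym_tensor X N) : R :=
  sup [set r | exists phi (n : nat) (l : 'I_n -> R) (x : 'I_n -> X),
    [/\ dual_ball phi, u = \sum_(i < n) l i *: stpow N (x i) &
        r = `|\sum_(i < n) l i * phi (x i) ^+ N|] ].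

Section PowerForm.
Variables (R : realType) (X : lmodType R) (N : nat) (phi : {scalar X}).

Lemma power_form_multilinear :
  multilinear (fun x : 'I_N -> X => \prod_(i < N) phi (x i) : R^o).
Proof.
move=> x i c u v.
have E w : \prod_(j < N) phi (dfwith x i w j) =
    phi w * \prod_(j < N | j != i) phi (x j).
  rewrite (bigD1 i) //= dfwithin; congr (_ * _).
  by apply: eq_bigr => j ji; rewrite dfwithout // eq_sym.
by rewrite !E linearP mulrDl -mulrA.
Qed.

Definition power_form := MForm power_form_multilinear.

Lemma power_formE (n : nat) (l : 'I_n -> R) (x : 'I_n -> X) :
  span_val (span_val (\sum_(i < n) l i *: stpow N (x i))) power_form =
  \sum_(i < n) l i * phi (x i) ^+ N.
Proof.
have -> : span_val (span_val (\sum_(i < n) l i *: stpow N (x i))) =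
    \sum_(i < n) l i *: eval_mform (fun=> x i : X).
  by rewrite !span_val_lin.
rewrite fct_sumE; apply: eq_bigr => i _.
by rewrite /eval_mform /= -[LHS]/(_ * \prod_(j < N) phi (x i)) prodr_const card_ord.
Qed.

End PowerForm.

Lemma inj_normE (R : realType) (X : normedModType R) (N n : nat)
    (l : 'I_n -> R) (x : 'I_n -> X) :
  inj_norm (\sum_(i < n) l i *: stpow N (x i)) =
  sup [set `|\sum_(i < n) l i * phi (x i) ^+ N| | phi in @dual_ball R X].
Proof.
congr sup; apply/seteqP; split=> [r [phi [m [k [y [bphi uE ->]]]]]|_ [phi bphi <-]].
  by exists phi => //; rewrite -!power_formE uE.
by exists phi, n, l, x.
Qed.

(* Y, with the linear map j, is a completion of the space E under the norm p. *)
Definition is_completion (R : realType) (E : lmodType R) (p : E -> R)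
    (Y : completeNormedModType R) (j : {linear E -> Y}) : Prop :=
  (forall u, `|j u| = p u) /\ dense (range j).

(* Main.v *)
(** Let u_1, ..., u_n be symmetric tensors and E the span of the vectors they
    involve. Octahedrality of X, applied twice, gives unit vectors y and z with
    |v + t y + s z| almost |v| + |t| + |s| for v in E, so that every functional
    phi in the dual ball can be modified, almost without changing it on E, to take
    prescribed values of modulus at most 1 at y and z. The tensor w = y^N (N odd)
    or w = y^N - z^N (N even) has norm at most 1; if phi almost norms u_i, a
    modification of phi still does and sends w close to the sign of its value at
    u_i, whence |u_i + w| is almost |u_i| + 1. *)
Require Import Defs.
From HB Require Import structures.
From mathcomp Require Import all_boot all_order all_algebra.
From mathcomp Require Import all_classical all_reals all_analysis.
From mathcomp Require Import ring lra.
Set Implicit Arguments.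
Unset Strict Implicit.
Unset Printing Implicit Defensive.

Import Order.TTheory GRing.Theory Num.Theory.
Import numFieldNormedType.Exports.
Local Open Scope classical_set_scope.
Local Open Scope ring_scope.

(** * Sublinear functionals and the Hahn-Banach theorem *)

Definition sublinear (R : realType) (V : lmodType R) (p : V -> R) : Prop :=
  (forall x y, p (x + y) <= p x + p y) /\
  (forall t x, 0 < t -> p (t *: x) <= t * p x).

Lemma sublinear0 (R : realType) (V : lmodType R) (p : V -> R) :
  sublinear p -> p 0 = 0.
Proof.
move=> [_ pZ].
have := pZ 2 0 (ltr0n _ 2); have := pZ 2^-1 0.
rewrite !scaler0 invr_gt0 => /(_ (ltr0n _ 2)); lra.
Qed.

Lemma sublinearZ (R : realType) (V : lmodType R) (p : V -> R) t x :
  sublinear p -> 0 <= t -> p (t *: x) = t * p x.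
Proof.
move=> slp; rewrite le_eqVlt => /predU1P[<-|t0].
  by rewrite scale0r mul0r sublinear0.
apply/eqP; rewrite eq_le slp.2//= -ler_pdivlMl//.
by rewrite -{1}[x]scale1r -(mulVf (lt0r_neq0 t0)) -scalerA slp.2 ?invr_gt0.
Qed.

(** A pair [d], [r] encodes the constraint [q d <= r] on a sublinear functional [q] to be found;
    such constraints can be added and multiplied by positive scalars. *)
Definition convex_cone (R : realType) (V : lmodType R) (C : V -> R -> Prop) :
    Prop :=
  [/\ C 0 0, forall d e r s, C d r -> C e s -> C (d + e) (r + s) &
      forall t d r, 0 < t -> C d r -> C (t *: d) (t * r)].

(* The infimal convolution of p with the cone. *)
Lemma sublinear_below_cone (R : realType) (V : lmodType R) (p : V -> R)
    (C : V -> R -> Prop) :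
  sublinear p -> convex_cone C -> (forall d r, C d r -> 0 <= p (- d) + r) ->
  exists q, [/\ sublinear q, forall x, q x <= p x & forall d r, C d r -> q d <= r].
Proof.
move=> slp [C0 CD CZ] Cp.
pose E x := [set a | exists d r, C d r /\ a = p (x - d) + r].
have E0 x : E x !=set0 by exists (p (x - 0) + 0), 0, 0.
have Elb x : has_lbound (E x).
  exists (- p (- x)) => _ [d [r [Cdr ->]]].
  have := slp.1 (x - d) (- x); rewrite addrAC subrr add0r.
  by have := Cp _ _ Cdr; lra.
have Einf x d r : C d r -> inf (E x) <= p (x - d) + r.
  by move=> Cdr; apply: ge_inf => //; exists d, r.
exists (fun x => inf (E x)); split.
- split=> [x y|t x t0].
    rewrite -lerBlDr; apply: lb_le_inf => // _ [d [r [Cdr ->]]].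
    rewrite lerBlDr -lerBlDl; apply: lb_le_inf => // _ [e [s [Ces ->]]].
    rewrite lerBlDl; apply: (le_trans (Einf _ _ _ (CD _ _ _ _ Cdr Ces))).
    have := slp.1 (x - d) (y - e); rewrite opprD addrACA; lra.
  rewrite -ler_pdivrMl//; apply: lb_le_inf => // _ [d [r [Cdr ->]]].
  rewrite ler_pdivrMl//; apply: (le_trans (Einf _ _ _ (CZ _ _ _ t0 Cdr))).
  by rewrite -scalerBr mulrDr lerD2r slp.2.
- by move=> x; have := Einf x _ _ C0; rewrite subr0 addr0.
- by move=> d r Cdr; have := Einf d _ _ Cdr; rewrite subrr sublinear0// add0r.
Qed.

(** This bounds the chains in Zorn's lemma. The pointwise infimum stays subadditive because, of two
    members of a chain, the smaller serves at both points. *)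
Lemma sublinear_inf_chain (R : realType) (V : lmodType R) (p : V -> R)
    (A : set (V -> R)) :
  A !=set0 -> (forall q, A q -> sublinear q /\ forall x, q x <= p x) ->
  (forall q q', A q -> A q' ->
    (forall x, q x <= q' x) \/ (forall x, q' x <= q x)) ->
  exists q0, [/\ sublinear q0, forall x, q0 x <= p x &
    forall q x, A q -> q0 x <= q x].
Proof.
move=> [q1 Aq1] Ap tot.
pose E x := [set q x | q in A].
have E0 x : E x !=set0 by exists (q1 x), q1.
have Elb x : has_lbound (E x).
  exists (- p (- x)) => _ [q Aq <-]; have [slq qp] := Ap _ Aq.
  have := slq.1 x (- x); rewrite subrr sublinear0//.
  by have := qp (- x); lra.
have Einf q x : A q -> inf (E x) <= q x by move=> Aq; apply: ge_inf => //; exists q.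
exists (fun x => inf (E x)); split.
- split=> [x y|t x t0].
    rewrite -lerBlDr; apply: lb_le_inf => // _ [q Aq <-].
    rewrite lerBlDr -lerBlDl; apply: lb_le_inf => // _ [q' Aq' <-].
    rewrite lerBlDl; have [le|le] := tot _ _ Aq Aq'.
      apply: (le_trans (Einf q _ Aq)); have := (Ap _ Aq).1.1 x y.
      by have := le y; lra.
    apply: (le_trans (Einf q' _ Aq')); have := (Ap _ Aq').1.1 x y.
    by have := le x; lra.
  rewrite -ler_pdivrMl//; apply: lb_le_inf => // _ [q Aq <-].
  rewrite ler_pdivrMl//; apply: (le_trans (Einf q _ Aq)).
  exact: (Ap _ Aq).1.2.
- by move=> x; apply: le_trans (Einf _ _ Aq1) ((Ap _ Aq1).2 x).
- by move=> q x; exact: Einf.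
Qed.

(** Oddness turns subadditivity at [x + y] and [- y] into superadditivity at [x] and [y]. *)
Lemma sublinear_oddP (R : realType) (V : lmodType R) (q : V -> R) :
  sublinear q -> (forall x, q (- x) <= - q x) -> exists f : {scalar V}, q = f.
Proof.
move=> slq qN.
have qNE x : q (- x) = - q x.
  apply/eqP; rewrite eq_le qN /=.
  by have := slq.1 x (- x); rewrite subrr sublinear0//; lra.
have qD x y : q (x + y) = q x + q y.
  apply/eqP; rewrite eq_le slq.1 /=.
  by have := slq.1 (x + y) (- y); rewrite addrK qNE; lra.
have qZ t x : q (t *: x) = t * q x.
  have [t0|t0] := leP 0 t; first exact: sublinearZ.
  rewrite -[t]opprK scaleNr qNE sublinearZ// ?mulNr//; lra.
have linq : linear_for *%R q by move=> t x y; rewrite qD qZ.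
pose f : {scalar V} := HB.pack q (GRing.isLinear.Build _ _ _ _ q linq).
by exists f.
Qed.

(* A pointwise minimal sublinear functional q is linear: otherwise it could be
   lowered along the ray of - x until q (- x) <= - q x. *)
Lemma hahn_banach (R : realType) (V : lmodType R) (p : V -> R) :
  sublinear p -> exists f : {scalar V}, forall x, f x <= p x.
Proof.
move=> slp.
pose T := {q : V -> R | sublinear q /\ forall x, q x <= p x}.
(* The order is reversed, so that a maximal element is a pointwise minimal functional. *)
pose Rel (q q' : T) := `[< forall x, sval q' x <= sval q x >].
have [||A totA|[q [slq qp]] qmin] := @ZL_preorder T (exist _ p (conj slp (fun=> lexx _))) Rel.
- by move=> q; apply/asboolP.
- move=> q1 q2 q3 /asboolP le12 /asboolP le23; apply/asboolP => x.
  exact: le_trans (le23 x) (le12 x).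
- have [->|/set0P[a Aa]] := eqVneq A set0.
    by exists (exist _ p (conj slp (fun=> lexx _))).
  have [||q q' [s As <-] [s' As' <-]|q0 [slq0 q0p q0A]] :=
      @sublinear_inf_chain _ _ p (sval @` A).
  + by exists (sval a); exists a.
  + by move=> q [s _ <-]; exact: (svalP s).
  + by case: (totA _ _ As As') => /asboolP; [right|left].
  + exists (exist _ q0 (conj slq0 q0p)) => s As; apply/asboolP => x /=.
    by apply: q0A; exists s.
suff qN x : q (- x) <= - q x.
  by have [f qf] := sublinear_oddP slq qN; exists f => x; rewrite -qf.
pose C d r := exists t, [/\ 0 <= t, d = - (t *: x) & r = - (t * q x)].
have [||q' [slq' q'q q'C]] := @sublinear_below_cone _ _ q C slq.
- split.
  + by exists 0; split; rewrite ?scale0r ?mul0r ?oppr0.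
  + move=> _ _ _ _ [t [t0 -> ->]] [s [s0 -> ->]]; exists (t + s).
    by split; [lra|rewrite scalerDl opprD|rewrite mulrDl opprD].
  + move=> s _ _ s0 [t [t0 -> ->]]; exists (s * t).
    by split; [apply: mulr_ge0 => //; lra|rewrite scalerN scalerA|rewrite mulrN mulrA].
- by move=> _ _ [t [t0 -> ->]]; rewrite opprK sublinearZ// subrr.
have q'p y : q' y <= p y by apply: le_trans (q'q y) (qp y).
have /asboolP qq' := qmin (exist _ q' (conj slq' q'p)) (introT (asboolP _) q'q).
apply: (le_trans (qq' _)); apply: q'C; exists 1.
by split; rewrite ?scale1r ?mul1r.
Qed.

(** * Functionals in the dual ball with approximately prescribed values *)

Lemma dual_ball_le (R : realType) (X : normedModType R) (f : {scalar X}) x :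
  dual_ball f -> `|f x| <= `|x|.
Proof.
move=> bf; have [->|x0] := eqVneq x 0; first by rewrite linear0 !normr0.
have nx : 0 < `|x| by rewrite normr_gt0.
have := bf (`|x|^-1 *: x); rewrite linearZ/= normrZ normrM normfV normr_id.
rewrite mulVf ?gt_eqF// => /(_ (lexx _)).
by rewrite ler_pdivrMl// mulr1.
Qed.

(* An approximate form of Helly's theorem on systems of linear equations; the
   tolerance eta makes linear independence of the v i irrelevant. *)
Lemma approx_helly (R : realType) (X : normedModType R) (I : finType)
    (v : I -> X) (a : I -> R) (eta : R) : 0 <= eta ->
  (forall c : I -> R, \sum_i c i * a i <=
     `|\sum_i c i *: v i| + eta * \sum_i `|c i|) ->
  exists2 f : {scalar X}, dual_ball f & forall i, `|f (v i) - a i| <= eta.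
Proof.
move=> eta0 H.
(* Taking [c] equal to 1 or -1 at one index and 0 elsewhere, these constraints yield the two halves
   of [|f (v i) - a i| <= eta]. *)
pose C (d : X) r := exists c : I -> R,
  d = \sum_i c i *: v i /\ \sum_i c i * a i + eta * \sum_i `|c i| <= r.
have [||d r [c [-> cr]]|q [slq qle qC]] :=
    @sublinear_below_cone _ _ (fun x : X => `|x|) C.
- split=> [x y|t x t0]; first exact: ler_normD.
  by rewrite normrZ gtr0_norm.
- split.
  + exists (fun=> 0); split.
      by rewrite big1// => i _; rewrite scale0r.
    rewrite big1; last by move=> i _; rewrite mul0r.
    by rewrite big1 ?mulr0 ?addr0// => i _; exact: normr0.
  + move=> _ _ r s [c [-> cr]] [b [-> bs]]; exists (fun i => c i + b i); split.
      by rewrite -big_split; apply: eq_bigr => i _; rewrite scalerDl.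
    apply: le_trans (lerD cr bs); rewrite addrACA; apply: lerD.
      by rewrite -big_split; apply: ler_sum => i _; rewrite mulrDl.
    rewrite -mulrDr ler_wpM2l// -big_split; apply: ler_sum => i _.
    exact: ler_normD.
  + move=> t _ r t0 [c [-> cr]]; exists (fun i => t * c i); split.
      by rewrite scaler_sumr; apply: eq_bigr => i _; rewrite scalerA.
    rewrite -(ler_pM2l t0) in cr; apply: le_trans cr.
    rewrite mulrDr mulrCA !mulr_sumr; apply: lerD; apply: ler_sum => i _.
      by rewrite mulrA.
    by rewrite normrM gtr0_norm// mulrCA.
- have := H (fun i => - c i).
  under eq_bigr do rewrite mulNr; under [X in `|X|]eq_bigr do rewrite scaleNr.
  under [X in _ + _ * X]eq_bigr do rewrite normrN.
  by rewrite !sumrN; lra.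
have [f fq] := hahn_banach slq.
have fb x : f x <= `|x| by apply: le_trans (fq x) (qle x).
exists f => [x x1|i].
  by rewrite ler_norml lerNl -raddfN; apply/andP; split;
    apply: (le_trans (fb _)); rewrite ?normrN.
have E (s : R) : `|s| = 1 -> s * f (v i) <= s * a i + eta.
  move=> s1; rewrite -linearZ; apply: (le_trans (fq _)); apply: qC.
  exists (fun k => if k == i then s else 0); split.
    by rewrite (bigD1 i)//= eqxx big1 ?addr0// => k /negPf ->; rewrite scale0r.
  rewrite (bigD1 i)//= eqxx big1 ?addr0; last by move=> k /negPf ->; rewrite mul0r.
  rewrite (bigD1 i)//= eqxx big1 ?addr0 ?s1 ?mulr1// => k /negPf ->.
  by rewrite normr0.
have := E 1 (normr1 _); have := E (-1); rewrite normrN normr1 => /(_ erefl).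
by rewrite ler_norml; lra.
Qed.

(** * Octahedrality and linear combinations *)

Lemma octahedral_fin (R : realType) (X : normedModType R) (I : finType)
    (x : I -> X) (e : R) :
  octahedral X -> (forall i, `|x i| = 1) -> 0 < e ->
  exists2 y : X, `|y| = 1 & forall i, 2 - e < `|x i + y|.
Proof.
move=> oct x1 e0; have [|y y1 xy] := oct #|I| (fun i => x (enum_val i)) e _ e0.
  by move=> i; exact: x1.
by exists y => // i; have := xy (enum_rank i); rewrite /= enum_rankK.
Qed.

(** For [r <= t], the vectors [t *: (x + y)] and [r *: x + t *: y] differ by [(t - r) *: x], which
    costs [t - r] in norm; the other case is symmetric. *)
Lemma near_diametral_ge (R : realType) (X : normedModType R) (x y : X)
    (delta r t : R) :
  `|x| = 1 -> `|y| = 1 -> 2 - delta < `|x + y| -> 0 <= delta ->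
  0 <= r -> 0 <= t -> r + t <= `|r *: x + t *: y| + delta * (r + t).
Proof.
move=> x1 y1 xy d0 r0 t0.
have dr : 0 <= delta * r by apply: mulr_ge0.
have dt : 0 <= delta * t by apply: mulr_ge0.
have [rt|tr] := leP r t.
  have E : t *: (x + y) = (r *: x + t *: y) + (t - r) *: x.
    by rewrite addrAC -scalerDl [r + _]addrC addrNK scalerDr.
  have := ler_normD (r *: x + t *: y) ((t - r) *: x); rewrite -E !normrZ x1.
  rewrite !ger0_norm ?subr_ge0//.
  by have := ler_wpM2l t0 (ltW xy); lra.
have E : r *: (x + y) = (r *: x + t *: y) + (r - t) *: y.
  by rewrite -addrA -scalerDl [t + _]addrC addrNK scalerDr.
have := ler_normD (r *: x + t *: y) ((r - t) *: y); rewrite -E !normrZ y1.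
rewrite !ger0_norm ?subr_ge0 ?(ltW tr)//.
by have := ler_wpM2l r0 (ltW xy); lra.
Qed.

Lemma grid_approx (R : realType) (K : nat) (c : R) : (0 < K)%N -> `|c| <= 1 ->
  exists k : 'I_K.*2.+1, `|c - (k%:R / K%:R - 1)| <= K%:R^-1.
Proof.
move=> K0; rewrite ler_norml => /andP[c1 c2].
have K0R : 0 < K%:R :> R by rewrite ltr0n.
have cK : 0 <= (c + 1) * K%:R by rewrite mulr_ge0 ?ler0n//; lra.
have /andP[kl ku] := truncn_itv cK.
set k := Num.trunc _ in kl ku.
have kK : (k < K.*2.+1)%N.
  rewrite ltnS -(ler_nat R) (le_trans kl)// -muln2 natrM mulrC ler_pM2l//; lra.
exists (Ordinal kK) => /=.
have -> : c - (k%:R / K%:R - 1) = ((c + 1) * K%:R - k%:R) / K%:R.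
  by rewrite mulrBl mulfK ?gt_eqF//; lra.
rewrite normrM normfV (gtr0_norm K0R) ler_piMl ?invr_ge0 ?ler0n//.
by move: ku; rewrite -natr1 ler_norml; lra.
Qed.

Lemma ler_norm_lincomb (R : realType) (X : normedModType R) (I : finType)
    (v : I -> X) (c : I -> R) (k : R) : (forall i, `|c i| <= k) ->
  `|\sum_i c i *: v i| <= k * \sum_i `|v i|.
Proof.
move=> ck; apply: le_trans (ler_norm_sum _ _ _) _; rewrite mulr_sumr.
by apply: ler_sum => i _; rewrite normrZ ler_wpM2r.
Qed.

(* Measuring the error by the coefficients rather than by the combination allows
   dependent v: by homogeneity a finite grid of coefficients is enough. *)
Lemma octahedral_lincomb (R : realType) (X : normedModType R) (I : finType)
    (v : I -> X) (eta : R) : octahedral X -> 0 < eta ->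
  exists2 y : X, `|y| = 1 & forall (c : I -> R) t,
    `|\sum_i c i *: v i| + `|t| <=
    `|\sum_i c i *: v i + t *: y| + eta * (\sum_i `|c i| + `|t|).
Proof.
move=> oct eta0.
pose L (c : I -> R) := \sum_i c i *: v i.
have LZ k c : L (fun i => k * c i) = k *: L c.
  by rewrite /L scaler_sumr; apply: eq_bigr => i _; rewrite scalerA.
pose M := \sum_i `|v i|.
have M0 : 0 <= M by apply: sumr_ge0.
(* The empty family yields a unit vector, the default direction when a grid combination vanishes. *)
have [x0 x01 _] := octahedral_fin (x := fun i : void => match i with end) oct
  (fun i : void => match i with end) ltr01.
(* Half of [eta] pays for [near_diametral_ge], where [|L (g h)| + t <= M + 1]. The other half pays
   for passing to the grid and back, at most [M / K] each way. *)
pose delta := eta / (2 * (M + 1)).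
have delta0 : 0 < delta by rewrite divr_gt0//; lra.
have deltaM : delta * (M + 1) = eta / 2 by rewrite /delta; field; lra.
pose K := (Num.trunc (4 * M / eta)).+1.
have K0R : 0 < K%:R :> R by rewrite ltr0n.
have KM : 2 * (K%:R^-1 * M) <= eta / 2.
  have /andP[_] : (Num.trunc (4 * M / eta))%:R <= 4 * M / eta < K%:R.
    by apply: truncn_itv; apply: divr_ge0; lra.
  rewrite ltr_pdivrMr// mulrCA -(ler_pM2l K0R) mulVKf ?gt_eqF//; lra.
pose g (h : {ffun I -> 'I_K.*2.+1}) i : R := (h i)%:R / K%:R - 1.
have g1 h i : `|g h i| <= 1.
  have : (h i)%:R / K%:R <= 2 :> R.
    by rewrite ler_pdivrMr// mulrC -natrM muln2 ler_nat -ltnS.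
  have : 0 <= (h i)%:R / K%:R :> R by rewrite divr_ge0.
  by rewrite ler_norml /g; lra.
pose x h := if L (g h) == 0 then x0 else `|L (g h)|^-1 *: L (g h).
have xE h : L (g h) = `|L (g h)| *: x h.
  rewrite /x; case: eqVneq => [->|Lh]; first by rewrite normr0 scale0r.
  by rewrite scalerA mulfV ?normr_eq0// scale1r.
have x1 h : `|x h| = 1.
  rewrite /x; case: eqVneq => // Lh.
  by rewrite normrZ normfV normr_id mulVf// normr_eq0.
have [y y1 xy] := octahedral_fin oct x1 delta0.
have small c t : (forall i, `|c i| <= 1) -> 0 <= t -> t <= 1 ->
    `|L c| + t <= `|L c + t *: y| + eta.
  move=> c1 t0 t1.
  have [h ch] : exists h, forall i, `|c i - g h i| <= K%:R^-1.
    have /choice[h hP] i := grid_approx (ltn0Sn _ : 0 < K)%N (c1 i).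
    by exists [ffun i => h i] => i; rewrite /g ffunE.
  have Lch : `|L c - L (g h)| <= K%:R^-1 * M.
    rewrite /L -sumrB; under eq_bigr do rewrite -scalerBl.
    exact: ler_norm_lincomb.
  have Lh : `|L (g h)| <= M.
    by rewrite -[M]mul1r; exact: ler_norm_lincomb.
  have := near_diametral_ge (x1 h) y1 (xy h) (ltW delta0) (normr_ge0 (L (g h))) t0.
  rewrite -xE.
  have : delta * (`|L (g h)| + t) <= delta * (M + 1).
    by rewrite ler_wpM2l ?(ltW delta0)// lerD.
  have := lerB_dist (L c) (L (g h)).
  have := ler_distD (L c + t *: y) (L (g h) + t *: y) 0.
  rewrite !subr0 opprD addrACA subrr addr0 (distrC (L (g h))); lra.
(* Dividing by [S] brings the coefficients into the range of [small]; multiplying back turns the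
   error [eta] into [eta * S]. *)
have pos c t : 0 <= t ->
    `|L c| + t <= `|L c + t *: y| + eta * (\sum_i `|c i| + t).
  move=> t0; set S := \sum_i _ + t.
  have c0 : 0 <= \sum_i `|c i| by apply: sumr_ge0.
  have cS i : `|c i| <= S.
    rewrite /S (bigD1 i)//= -addrA lerDl addr_ge0//; exact: sumr_ge0.
  have [S0|S0] := leP S 0.
    have -> : L c = 0.
      apply: big1 => i _; have := cS i.
      by have := normr_ge0 (c i) => ? ?; rewrite (normr0_eq0 (x := c i)) ?scale0r//; lra.
    have -> : t = 0 by rewrite /S in S0; lra.
    have -> : S = 0 by rewrite /S in S0 *; lra.
    by rewrite mulr0 scale0r !addr0.
  have c1 i : `|S^-1 * c i| <= 1.
    by rewrite normrM normfV (gtr0_norm S0) ler_pdivrMl// mulr1.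
  have t1 : 0 <= S^-1 * t by rewrite mulr_ge0// invr_ge0 ltW.
  have t2 : S^-1 * t <= 1 by rewrite ler_pdivrMl// mulr1 /S lerDr.
  have := small _ _ c1 t1 t2.
  rewrite LZ -scalerA -scalerDr !normrZ normfV (gtr0_norm S0) -mulrDr.
  by rewrite ler_pdivrMl// mulrDr mulVKf ?gt_eqF// [S * eta]mulrC.
exists y => // c t; have [t0|t0] := leP 0 t; first by rewrite (ger0_norm t0); exact: pos.
have nt0 : 0 <= - t by lra.
have := pos (fun i => -1 * c i) _ nt0; rewrite LZ scaleN1r normrN.
rewrite scaleNr -opprD normrN (ltr0_norm t0).
by under eq_bigr do rewrite mulN1r normrN.
Qed.

Lemma big_option (R : nmodType) (I : finType) (F : option I -> R) :
  \sum_o F o = F None + \sum_i F (Some i).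
Proof.
rewrite (bigD1 None)//=; congr (_ + _).
rewrite (reindex_omap Some id) => [|[]//].
by apply: eq_bigl => i /=; rewrite eqxx.
Qed.

(** Choosing [z] for the family enlarged by [y] makes the norm almost additive in both directions at
    once. This is the hypothesis of [approx_helly] for the values [phi (v i)], [a] and [b]; each
    choice costs [eta / 2]. *)
Lemma octahedral_functional (R : realType) (X : normedModType R) (I : finType)
    (v : I -> X) (eta : R) : octahedral X -> 0 < eta ->
  exists y z : X, [/\ `|y| = 1, `|z| = 1 & forall (phi : {scalar X}) (a b : R),
    dual_ball phi -> `|a| <= 1 -> `|b| <= 1 ->
    exists psi : {scalar X}, [/\ dual_ball psi,
      forall i, `|psi (v i) - phi (v i)| <= eta,
      `|psi y - a| <= eta & `|psi z - b| <= eta]].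
Proof.
move=> oct eta0; have eta20 : 0 < eta / 2 by lra.
have [y y1 yP] := octahedral_lincomb v oct eta20.
pose v' o := if o is Some i then v i else y.
have [z z1 zP] := octahedral_lincomb v' oct eta20.
exists y, z; split=> // phi a b bphi a1 b1.
pose w o := if o is Some o' then v' o' else z.
pose t o := if o is Some o' then if o' is Some i then phi (v i) else a else b.
have [|psi bpsi psiP] := @approx_helly R X _ w t eta (ltW eta0).
  move=> c; rewrite !big_option /=.
  have := zP (c \o Some) (c None); have := yP (c \o Some \o Some) (c (Some None)).
  rewrite !big_option /=.
  set d := \sum_i c (Some (Some i)) *: v i.
  have := ler_norm (c None * b); rewrite normrM.
  have := ler_piMr (normr_ge0 (c None)) b1.
  have := ler_norm (c (Some None) * a); rewrite normrM.
  have := ler_piMr (normr_ge0 (c (Some None))) a1.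
  have : \sum_i c (Some (Some i)) * phi (v i) <= `|d|.
    apply: le_trans (dual_ball_le d bphi); apply: le_trans (ler_norm _).
    by rewrite linear_sum; apply: ler_sum => i _; rewrite linearZ.
  have : 0 <= eta * `|c None| by rewrite mulr_ge0// ltW.
  rewrite [c (Some None) *: y + d]addrC [c None *: z + _]addrC; lra.
exists psi; split=> // [i||].
- exact: (psiP (Some (Some i))).
- exact: (psiP (Some None)).
- exact: (psiP None).
Qed.

(** * Pairing of symmetric tensors with power forms, and the tensor [w] *)

Lemma ler_norm_subX (R : realType) (a b M : R) (n : nat) :
  1 <= M -> `|a| <= M -> `|b| <= M ->
  `|a ^+ n - b ^+ n| <= n%:R * M ^+ n * `|a - b|.
Proof.
move=> M1 aM bM; elim: n => [|n IH]; first by rewrite subrr normr0 !mul0r.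
have -> : a ^+ n.+1 - b ^+ n.+1 = a * (a ^+ n - b ^+ n) + b ^+ n * (a - b).
  by rewrite !exprS; ring.
apply: le_trans (ler_normD _ _) _; rewrite !normrM normrX.
have Mn : M ^+ n <= M ^+ n.+1 by rewrite exprS ler_peMl// exprn_ge0//; lra.
have bn : `|b| ^+ n <= M ^+ n.+1 by apply: le_trans Mn; rewrite lerXn2r// ?nnegrE; lra.
have E : n.+1%:R * M ^+ n.+1 * `|a - b| =
    M * (n%:R * M ^+ n * `|a - b|) + M ^+ n.+1 * `|a - b|.
  by rewrite -natr1 exprS; ring.
by rewrite E lerD ?ler_pM ?ler_wpM2r.
Qed.

Section Pairing.
Variables (R : realType) (X : normedModType R) (N : nat).
Implicit Types (u w : sym_tensor X N) (phi psi : {scalar X}).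

(** Tensors being functionals on N-linear forms, this is the sum of the [l i * phi (x i) ^+ N] for
    any representation of [u]. *)
Definition pairing u phi : R := span_val (span_val u) (power_form N phi).

Lemma pairingD u w phi : pairing (u + w) phi = pairing u phi + pairing w phi.
Proof.
rewrite /pairing.
have -> : span_val (u + w) = span_val u + span_val w by exact: SubK.
have -> : span_val (span_val u + span_val w) =
    span_val (span_val u) + span_val (span_val w) by exact: SubK.
by [].
Qed.

Lemma pairingZ c u phi : pairing (c *: u) phi = c * pairing u phi.
Proof. by rewrite /pairing !span_valZ. Qed.

Lemma pairing_stpow x phi : pairing (stpow N x) phi = phi x ^+ N.
Proof.
by rewrite -[LHS]/(\prod_(i < N) phi x) prodr_const card_ord.
Qed.

Lemma inj_norm_le u k :
  (forall phi, dual_ball phi -> `|pairing u phi| <= k) -> inj_norm u <= k.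
Proof.
move=> uk; apply: ge_sup.
  have [n [l [x uE]]] := sym_tensorP u.
  (* The zero functional shows that the supremum is over a nonempty set. *)
  pose phi0 : {scalar X} := [the {linear X -> R^o} of \0].
  exists `|\sum_(i < n) l i * phi0 (x i) ^+ N|, phi0, n, l, x; split=> //.
  by move=> y _; rewrite normr0.
by move=> _ [phi [n [l [x [bphi uE ->]]]]]; rewrite -power_formE -uE; exact: uk.
Qed.

Lemma pairing_le u phi : dual_ball phi -> `|pairing u phi| <= inj_norm u.
Proof.
move=> bphi; have [n [l [x uE]]] := sym_tensorP u.
apply: ub_le_sup; last first.
  by exists phi, n, l, x; split=> //; rewrite -power_formE -uE.
exists (\sum_(i < n) `|l i| * `|x i| ^+ N) => _ [psi [m [k [y [bpsi uE' ->]]]]].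
rewrite -power_formE -uE' uE power_formE; apply: le_trans (ler_norm_sum _ _ _) _.
apply: ler_sum => i _; rewrite normrM normrX ler_wpM2l//.
by rewrite lerXn2r ?nnegrE//; exact: dual_ball_le.
Qed.

Lemma inj_norm_attained u r : r < inj_norm u ->
  exists2 phi, dual_ball phi & r < `|pairing u phi|.
Proof.
move=> ru; apply: contrapT => nphi.
suff : inj_norm u <= r by lra.
apply: inj_norm_le => phi bphi; rewrite leNgt; apply/negP => rphi.
by apply: nphi; exists phi.
Qed.

(** A tensor sees a functional only through its values at the points of one representation, and N-th
    powers are Lipschitz on bounded intervals. *)
Lemma pairing_lipschitz u : exists (n : nat) (x : 'I_n -> X) (C : R),
  0 <= C /\ forall phi psi eta, dual_ball phi -> dual_ball psi ->
    (forall i, `|psi (x i) - phi (x i)| <= eta) ->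
    `|pairing u psi - pairing u phi| <= C * eta.
Proof.
have [n [l [x ->]]] := sym_tensorP u.
pose M : R := 1 + \sum_i `|x i|.
have s0 : 0 <= \sum_i `|x i| by apply: sumr_ge0.
have M1 : 1 <= M by rewrite /M; lra.
have M0 : 0 <= M by rewrite /M; lra.
have xM i : `|x i| <= M.
  rewrite /M (bigD1 i)//= addrCA lerDl addr_ge0//; exact: sumr_ge0.
have bM phi i : dual_ball phi -> `|phi (x i)| <= M.
  by move=> bphi; apply: le_trans (dual_ball_le _ bphi) (xM i).
exists n, x, (\sum_i `|l i| * (N%:R * M ^+ N)); split.
  by apply: sumr_ge0 => i _; rewrite !mulr_ge0// exprn_ge0.
move=> phi psi eta bphi bpsi close.
rewrite /pairing !power_formE -sumrB mulr_suml.
apply: le_trans (ler_norm_sum _ _ _) _; apply: ler_sum => i _.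
rewrite -mulrBr normrM -mulrA ler_wpM2l//.
apply: le_trans (ler_norm_subX N M1 (bM _ i bpsi) (bM _ i bphi)) _.
by rewrite ler_wpM2l// mulr_ge0// exprn_ge0.
Qed.

End Pairing.

(* For even N every N-th power pairs nonnegatively with the power forms, so that
   the value -1 has to be produced by subtracting a second N-th power. *)
Lemma sym_tensor_spread (R : realType) (X : normedModType R) (N n : nat)
    (u : 'I_n -> sym_tensor X N) (delta : R) :
  octahedral X -> (0 < N)%N -> 0 < delta ->
  exists2 w : sym_tensor X N, inj_norm w <= 1 &
    forall (phi : {scalar X}) (s : bool), dual_ball phi ->
    exists psi : {scalar X}, [/\ dual_ball psi,
      forall i, `|pairing (u i) psi - pairing (u i) phi| <= delta &
      `|pairing w psi - (-1) ^+ s| <= delta].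
Proof.
move=> oct N0 delta0.
have [m mP] := all_sig (fun i => cid (pairing_lipschitz (u i))).
have [x xP] := all_sig (fun i => cid (mP i)); have /choice[C CP] := xP.
(* [C i] controls the change of the pairing with [u i], and [2 * N] the two N-th powers in [w]. *)
pose K := 1 + \sum_i C i + 2 * N%:R.
have C0 : 0 <= \sum_i C i by apply: sumr_ge0 => i _; have [] := CP i.
have N0R : 0 <= N%:R :> R by rewrite ler0n.
have K0 : 0 < K by rewrite /K; lra.
pose eta := delta / K.
have eta0 : 0 < eta by rewrite divr_gt0.
have etaK : K * eta = delta by rewrite mulrCA mulfV ?mulr1 ?gt_eqF.
have [y [z [y1 z1 ext]]] :=
  octahedral_functional (fun p : {i : 'I_n & 'I_(m i)} => x _ (tagged p)) oct eta0.
(* The coefficient is 0 for odd N and 1 for even N, which treats both forms of [w] together. *)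
pose c : R := (~~ odd N)%:R.
pose w := stpow N y - c *: stpow N z.
have wE phi : pairing w phi = phi y ^+ N - c * phi z ^+ N.
  by rewrite /w -scaleNr pairingD pairingZ !pairing_stpow mulNr.
have b1 (phi : {scalar X}) v : dual_ball phi -> `|v| = 1 -> `|phi v| <= 1.
  by move=> bphi v1; rewrite -v1; exact: dual_ball_le.
exists w.
  apply: inj_norm_le => phi bphi; rewrite wE /c.
  have yN : `|phi y ^+ N| <= 1 by rewrite normrX exprn_ile1// b1.
  have zN : `|phi z ^+ N| <= 1 by rewrite normrX exprn_ile1// b1.
  case: (boolP (odd N)) => oddN /=; first by rewrite mul0r subr0.
  have := exprn_even_ge0 (phi y) oddN; have := exprn_even_ge0 (phi z) oddN.
  by move: yN zN; rewrite mul1r !ler_norml; lra.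
move=> phi s bphi.
(* The sign +1 comes from [a = 1], [b = 0]; the sign -1 from [a = -1], [b = 0] for odd N and from
   [a = 0], [b = 1] for even N. *)
have [a [b [a1 b1' abs]]] : exists a b : R,
    [/\ `|a| <= 1, `|b| <= 1 & a ^+ N - c * b ^+ N = (-1) ^+ s].
  rewrite /c; case: s; last first.
    by exists 1, 0; rewrite normr1 normr0 expr1n expr0n gtn_eqF// mulr0 subr0.
  case: (boolP (odd N)) => oddN /=.
    exists (-1), 0; rewrite normrN normr1 normr0 mul0r subr0 expr1; split=> //.
    by rewrite -signr_odd oddN expr1.
  exists 0, 1; rewrite normr1 normr0 expr1n expr0n gtn_eqF// mulr1 sub0r.
  by rewrite expr1.
have [psi [bpsi psiP psiy psiz]] := ext phi a b bphi a1 b1'.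
exists psi; split=> // [i|].
  have [_ /(_ phi psi eta bphi bpsi)] := CP i.
  move=> /(_ (fun k => psiP (Tagged (fun i => 'I_(m i)) k))) /le_trans; apply.
  rewrite -etaK ler_wpM2r ?(ltW eta0)// /K (bigD1 i)//=.
  have : 0 <= \sum_(k < n | k != i) C k.
    by apply: sumr_ge0 => k _; have [] := CP k.
  lra.
have yB := ler_norm_subX N (lexx 1) (b1 _ _ bpsi y1) a1.
have zB := ler_norm_subX N (lexx 1) (b1 _ _ bpsi z1) b1'.
rewrite expr1n mulr1 in yB zB.
have yeta := ler_wpM2l N0R psiy; have zeta := ler_wpM2l N0R psiz.
have c1 : `|c| <= 1 by rewrite /c; case: odd; rewrite ?normr0 ?normr1.
have Ceta : 0 <= (1 + \sum_i C i) * eta by rewrite mulr_ge0 ?(ltW eta0)//; lra.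
rewrite wE -abs -etaK /K.
have -> : psi y ^+ N - c * psi z ^+ N - (a ^+ N - c * b ^+ N) =
  (psi y ^+ N - a ^+ N) - c * (psi z ^+ N - b ^+ N) by ring.
apply: le_trans (ler_normB _ _) _; rewrite normrM.
have := ler_piMl (normr_ge0 (psi z ^+ N - b ^+ N)) c1; lra.
Qed.

(** * Passage to the completion *)

Unset Implicit Arguments.

Theorem theorem3p1 (R : realType) (X : completeNormedModType R)
    (hX : exists x : X, x != 0) (N : nat) (hN : (0 < N)%N)
    (Y : completeNormedModType R) (j : {linear sym_tensor X N -> Y})
    (hj : is_completion (@inj_norm R X N) j) :
  octahedral X -> octahedral Y.
Proof.
move=> oct n y e y1 e0; have [jE jD] := hj.
(* The total loss is [6 * delta]: four in [sumw], one for replacing [y i] by [j (u i)], one for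
   normalising [j w]. The denominator also keeps [delta] below 1. *)
pose delta := e / (8 + 8 * e).
have delta0 : 0 < delta by rewrite divr_gt0//; lra.
have delta1 : delta < 1 by rewrite ltr_pdivrMr; lra.
have delta_e : 6 * delta < e.
  have : delta * (8 + 8 * e) = e by rewrite divfK// gt_eqF//; lra.
  by have : 0 < delta * e by [apply: mulr_gt0]; lra.
have /choice[u uy] i : exists u, `|y i - j u| < delta.
  have [|p [yu [u _ up]]] := jD _ _ (ball_open (y i) delta).
    by exists (y i); exact: ballxx.
  by exists u; rewrite up; rewrite -ball_normE in yu.
have [w w1 wP] := sym_tensor_spread u oct hN delta0.
have ju i : 1 - delta < inj_norm (u i).
  by rewrite -jE; have := lerB_dist (y i) (j (u i)); have := uy i; rewrite y1; lra.
have sumw i : 2 - 4 * delta < `|j (u i) + j w|.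
  have lt1 : 1 - delta - delta < inj_norm (u i) by have := ju i; lra.
  have [phi bphi phiu] := inj_norm_attained lt1.
  (* The boolean is the sign of the pairing with [u i], so that [w] adds to it in modulus. Here
     [phi] loses [2 * delta] and [psi] another [delta] on each of [u i] and [w]. *)
  have [psi [bpsi psiu psiw]] := wP phi (pairing (u i) phi < 0) bphi.
  rewrite -raddfD jE; apply: lt_le_trans (pairing_le _ bpsi).
  rewrite pairingD; move: phiu (psiu i) psiw.
  case: (ltP (pairing (u i) phi) 0) => [neg|pos].
    have := ler_norm (- (pairing (u i) psi + pairing w psi)).
    by rewrite normrN (ltr0_norm neg) expr1 !ler_norml; lra.
  have := ler_norm (pairing (u i) psi + pairing w psi).
  by rewrite (ger0_norm pos) expr0 !ler_norml; lra.
have jw1 : `|j w| <= 1 by rewrite jE.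
(* Modifying the zero functional bounds [w] from below even when the family is empty. *)
have jw : 1 - delta <= `|j w|.
  have [|psi [bpsi _]] := wP [the {linear X -> R^o} of \0] false.
    by move=> x _; rewrite normr0.
  rewrite jE expr0 ler_norml; have := pairing_le w bpsi.
  by rewrite ler_norml; lra.
have jw0 : 0 < `|j w| by lra.
exists (`|j w|^-1 *: j w).
  by rewrite normrZ normfV normr_id mulVf// gt_eqF.
move=> i; set v := _ *: _.
have vw : `|v - j w| = 1 - `|j w|.
  rewrite -[X in _ - X]scale1r -scalerBl normrZ -[X in _ * X]gtr0_norm// -normrM.
  rewrite mulrBl mulVf ?gt_eqF// mul1r ger0_norm//; lra.
have := ler_normD (y i + v) (j (u i) - y i + (j w - v)).
have -> : y i + v + (j (u i) - y i + (j w - v)) = j (u i) + j w.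
  by rewrite addrACA [y i + _]addrC addrNK [v + _]addrC addrNK.
have := ler_normD (j (u i) - y i) (j w - v).
rewrite (distrC (j (u i))) (distrC (j w)) vw.
by have := uy i; have := sumw i; lra.
Qed.
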